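(* Let $N\ge 2$, let $\mathcal{P}=\{\mathbb{S}_1,\dots,\mathbb{S}_N\}$ be a partition of $\{1,\dots,\eta\}$ and let $\mathcal{P}'$ be any partition into $N-1$ sets obtained from $\mathcal{P}$ by replacing two of its sets by their union. Then the formulation with the $N$ partitions $\mathcal{P}$ is strictly tighter than the formulation with the $N-1$ partitions $\mathcal{P}'$, i.e. $R(\mathcal{P})\subsetneq R(\mathcal{P}')$, where $R(\cdot)$ denotes the projected continuous relaxation defined in the context.
   Context: Setting: a ReLU node $y=\max(0,w^T x+b)$ with fixed weights $w\in\mathbb{R}^\eta$, $b\in\mathbb{R}$, and bounded inputs $x\in X=\prod_{i=1}^\eta[\underline{x}_i,\bar{x}_i]$. For a partition $\mathcal{P}=\{\mathbb{S}_1,\dots,\mathbb{S}_N\}$ of $\{1,\dots,\eta\}$ into pairwise disjoint nonempty sets, the $N$-partition formulation of the node has variables $x\in X$, $y\in[0,\infty)$, $\sigma$ (binary, relaxed to $[0,1]$ in the continuous relaxation), $z_1^b,\dots,z_N^b\in\mathbb{R}$, and constraints (P1) $\sum_{n=1}^N\big(\sum_{i\in\mathbb{S}_n}w_i x_i-z_n^b\big)+\sigma b\le 0$; (P2) $\sum_{n=1}^N z_n^b+(1-\sigma)b\ge 0$; (P3) $y=\sum_{n=1}^N z_n^b+(1-\sigma)b$; (P4) $\sigma\,\mathit{LB}_n^a\le\sum_{i\in\mathbb{S}_n}w_i x_i-z_n^b\le\sigma\,\mathit{UB}_n^a$ for $n=1,\dots,N$; (P5) $(1-\sigma)\,\mathit{LB}_n^b\le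 z_n^b\le(1-\sigma)\,\mathit{UB}_n^b$ for $n=1,\dots,N$. The bounds are the interval-arithmetic bounds over the box: $\mathit{LB}_n^a=\mathit{LB}_n^b=\sum_{i\in\mathbb{S}_n}\min(w_i\underline{x}_i,w_i\bar{x}_i)$ and $\mathit{UB}_n^a=\mathit{UB}_n^b=\sum_{i\in\mathbb{S}_n}\max(w_i\underline{x}_i,w_i\bar{x}_i)$. $R(\mathcal{P})$ is the set of $(x,y,\sigma)\in X\times[0,\infty)\times[0,1]$ for which there exist $z_1^b,\dots,z_N^b\in\mathbb{R}$ satisfying (P1)--(P5). One formulation is strictly tighter than another if its projected continuous relaxation $R$ is a proper subset of that of the other.
   Formalization: Strictness fails e.g. for w=0, so it is claimed only if the box is nonempty, both merged sets have LB<UB, and the total bounds satisfy LB+b ≤ 0 ≤ UB+b; in all other cases R(P)=R(P'). The inclusion R(P) ⊆ R(P') is proved for every nonempty box. *)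

(* Defs.v *)
From HB Require Import structures.
From mathcomp Require Import all_boot all_order all_algebra.
From mathcomp Require Import all_classical all_reals.
Set Implicit Arguments.
Unset Strict Implicit.
Unset Printing Implicit Defensive.
Import Order.TTheory GRing.Theory Num.Theory.
Local Open Scope classical_set_scope.
Local Open Scope ring_scope.

Section PartitionFormulation.
Context {R : realType} {eta : nat}.
Implicit Types (w lo hi x : 'cV[R]_eta) (S T : {set 'I_eta})
  (P : {set {set 'I_eta}}).

Definition box lo hi : set 'cV[R]_eta :=
  [set x | forall i, lo i 0 <= x i 0 <= hi i 0].

Definition partial_dot w x S : R := \sum_(i in S) w i 0 * x i 0.

(* The interval bounds serve both as (LB^a, UB^a) and as (LB^b, UB^b), which
   coincide; the bias is not included. *)
Definition LB w lo hi S : R :=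
  \sum_(i in S) Num.min (w i 0 * lo i 0) (w i 0 * hi i 0).
Definition UB w lo hi S : R :=
  \sum_(i in S) Num.max (w i 0 * lo i 0) (w i 0 * hi i 0).

(* The auxiliary variables z^b are indexed by the blocks of P themselves; the
   values of z outside P are irrelevant. *)
Record partition_constraints w (b : R) lo hi P x (y sigma : R)
    (z : {set 'I_eta} -> R) : Prop := PartitionConstraints {
  pc_inactive :
    \sum_(S in P) (partial_dot w x S - z S) + sigma * b <= 0;
  pc_active : 0 <= \sum_(S in P) z S + (1 - sigma) * b;
  pc_output : y = \sum_(S in P) z S + (1 - sigma) * b;
  pc_bounds_a : forall S, S \in P ->
    sigma * LB w lo hi S <= partial_dot w x S - z S <= sigma * UB w lo hi S;
  pc_bounds_b : forall S, S \in P ->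
    (1 - sigma) * LB w lo hi S <= z S <= (1 - sigma) * UB w lo hi S
}.

Definition relaxation w (b : R) lo hi P : set ('cV[R]_eta * R * R) :=
  [set p | let: (x, y, sigma) := p in
    [/\ box lo hi x, 0 <= y, 0 <= sigma <= 1 &
        exists z, partition_constraints w b lo hi P x y sigma z]].

Definition merge_blocks P S T : {set {set 'I_eta}} :=
  ((S :|: T) |: (P :\ S :\ T))%SET.

End PartitionFormulation.

(* Main.v *)
Require Import Defs.
From HB Require Import structures.
From mathcomp Require Import all_boot all_order all_algebra.
From mathcomp Require Import all_classical all_reals.
From mathcomp Require Import ring lra.
Set Implicit Arguments.
Unset Strict Implicit.
Unset Printing Implicit Defensive.
Import Order.TTheory GRing.Theory Num.Theory.
Local Open Scope classical_set_scope.
Local Open Scope ring_scope.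

(** Inclusion. Given auxiliary variables [z] for [P], give the merged block
    [S :|: T] the value [z S + z T]. The interval bounds and the partial dot
    products are additive over disjoint index sets, so the block constraints at
    [S :|: T] are the sums of those at [S] and at [T]; the aggregate constraints
    only see the sum of the [z], which does not change ([relaxation_merge]).

    Strictness. At [sigma = 1/2] the block constraints bound [z B] above by both
    [UB B / 2] and [partial_dot w x B - LB B / 2], so the largest possible output
    is [y = (UB setT + b) / 2]. It can be attained only if on each block the
    first bound is the smaller one, i.e. if [partial_dot w x B] is at least the
    midpoint of [LB B] and [UB B]. It therefore suffices to find [x] in the box
    which is at the midpoint on every block of the merged partition
    ([balanced_in_relaxation]) but below it on [S] ([deficient_not_in_relaxation]).
    Such an [x] has a deficit on [S] and a compensating excess on [T], which is
    possible as soon as both blocks have nondegenerate intervals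
    ([exists_unbalanced_pair]). The hypothesis [LB setT + b <= 0 <= UB setT + b]
    is what makes this [y] dominate both [0] and the pre-activation value. *)

Section Merging.
Context {R : realType} {eta : nat}.
Implicit Types (w lo hi x : 'cV[R]_eta) (b y sigma : R)
  (A B S T : {set 'I_eta}) (P Q : {set {set 'I_eta}}).

(** * Additivity over blocks *)

Lemma partial_dotU w x S T : [disjoint S & T]%B ->
  partial_dot w x (S :|: T)%SET = partial_dot w x S + partial_dot w x T.
Proof.
move=> dST; rewrite /partial_dot -bigU //=.
by apply: eq_bigl => i; rewrite !inE.
Qed.

Lemma LBU w lo hi S T : [disjoint S & T]%B ->
  LB w lo hi (S :|: T)%SET = LB w lo hi S + LB w lo hi T.
Proof.
move=> dST; rewrite /LB -bigU //=.
by apply: eq_bigl => i; rewrite !inE.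
Qed.

Lemma UBU w lo hi S T : [disjoint S & T]%B ->
  UB w lo hi (S :|: T)%SET = UB w lo hi S + UB w lo hi T.
Proof.
move=> dST; rewrite /UB -bigU //=.
by apply: eq_bigl => i; rewrite !inE.
Qed.

Lemma partition_sum_LB w lo hi P A : finset.partition P A ->
  \sum_(B in P) LB w lo hi B = LB w lo hi A.
Proof. by case/and3P=> /eqP <- tP _; rewrite /LB big_trivIset. Qed.

Lemma partition_sum_UB w lo hi P A : finset.partition P A ->
  \sum_(B in P) UB w lo hi B = UB w lo hi A.
Proof. by case/and3P=> /eqP <- tP _; rewrite /UB big_trivIset. Qed.

Lemma LB_le_UB w lo hi B : LB w lo hi B <= UB w lo hi B.
Proof. by apply: ler_sum => i _; rewrite ge_min !le_max lexx. Qed.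

Lemma partition_blocks_disjoint P A S T : finset.partition P A ->
  S \in P -> T \in P -> S != T -> [disjoint S & T]%B.
Proof. by case/and3P=> _ /finset.trivIsetP tP _; apply: tP. Qed.

(** A block of [P] equal to [S :|: T] would meet [S] in the nonempty [S], so it
    would have to be [S]; hence adding the union to the remaining blocks adds a
    genuinely new summand in [merge_blocks_sum]. *)
Lemma partition_union_notin P A S T : finset.partition P A ->
  S \in P -> T \in P -> S != T -> (S :|: T)%SET \notin (P :\ S :\ T)%SET.
Proof.
move=> partP SP TP neqST; rewrite !in_setD1.
apply/negP => /and3P[_ neqU UP].
have := partition_blocks_disjoint partP UP SP neqU.
rewrite -setI_eq0 finset.setUK => /eqP S0.
by case/and3P: partP => _ _ /negP; apply; rewrite -S0.
Qed.

Lemma merge_blocks_sum P A S T (F G : {set 'I_eta} -> R) :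
    finset.partition P A -> S \in P -> T \in P -> S != T ->
    F (S :|: T)%SET = G S + G T ->
    (forall B, B \in (P :\ S :\ T)%SET -> F B = G B) ->
  \sum_(B in merge_blocks P S T) F B = \sum_(B in P) G B.
Proof.
move=> partP SP TP neqST FU FG.
rewrite /merge_blocks big_setU1 ?(partition_union_notin partP) //=.
rewrite [RHS](big_setD1 S) //= (big_setD1 T (A := P :\ S)%SET) /=; last first.
  by rewrite !inE eq_sym neqST.
by rewrite FU addrA; congr (_ + _); apply: eq_bigr.
Qed.

Lemma merge_blocksP P S T B : B \in merge_blocks P S T ->
  B = (S :|: T)%SET \/ B \in (P :\ S :\ T)%SET.
Proof. by case/setU1P; [left | right]. Qed.

(** * Merging two blocks weakens the formulation *)

Lemma relaxation_merge w b lo hi P A S T :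
    finset.partition P A -> S \in P -> T \in P -> S != T ->
  relaxation w b lo hi P `<=` relaxation w b lo hi (merge_blocks P S T).
Proof.
move=> partP SP TP neqST [[x y] s] /= [xbox y0 s01 [z [inact act out bda bdb]]].
split=> //.
have dST := partition_blocks_disjoint partP SP TP neqST.
have UnP := partition_union_notin partP SP TP neqST.
pose z' B := if B == (S :|: T)%SET then z S + z T else z B.
have z'U : z' (S :|: T)%SET = z S + z T by rewrite /z' eqxx.
have z'E B : B \in (P :\ S :\ T)%SET -> z' B = z B.
  by rewrite /z'; case: eqP => // -> BP; rewrite BP in UnP.
have sumz : \sum_(B in merge_blocks P S T) z' B = \sum_(B in P) z B.
  exact: (merge_blocks_sum partP).
exists z'; split; rewrite ?sumz //.
- rewrite (merge_blocks_sum (G := fun B => partial_dot w x B - z B) partP) //.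
    by rewrite z'U partial_dotU //; ring.
  by move=> B /z'E ->.
- move=> B /merge_blocksP[->|BP].
    by rewrite z'U partial_dotU // LBU // UBU //; move: (bda S SP) (bda T TP); lra.
  by rewrite z'E //; apply: bda; move: BP; rewrite !inE => /and3P[].
- move=> B /merge_blocksP[->|BP].
    by rewrite z'U LBU // UBU //; move: (bdb S SP) (bdb T TP); lra.
  by rewrite z'E //; apply: bdb; move: BP; rewrite !inE => /and3P[].
Qed.

(** * The extreme output at sigma = 1/2 *)

(** The witness is [z B = UB B / 2], which leaves [LB B / 2] for the other
    half of the dot product, the extreme admissible value in both bounds. The
    sums over [Q] are hypotheses so that the lemma applies to a merged
    partition through [merge_blocks_sum]. *)
Lemma balanced_in_relaxation w b lo hi Q (l u : R) x :
    \sum_(B in Q) LB w lo hi B = l -> \sum_(B in Q) UB w lo hi B = u ->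
    l + b <= 0 <= u + b -> box lo hi x ->
    (forall B, B \in Q ->
       partial_dot w x B = (LB w lo hi B + UB w lo hi B) / 2) ->
  relaxation w b lo hi Q (x, (u + b) / 2, 2^-1).
Proof.
move=> sumL sumU lub xbox xmid.
have sumz : \sum_(B in Q) UB w lo hi B / 2 = u / 2 by rewrite -mulr_suml sumU.
split=> //; [by lra | by lra | exists (fun B => UB w lo hi B / 2)].
split; rewrite ?sumz; [ | lra | lra | | ].
- rewrite (eq_bigr (fun B => LB w lo hi B / 2)); last first.
    by move=> B /xmid ->; field.
  by rewrite -mulr_suml sumL; lra.
- by move=> B /xmid ->; have := LB_le_UB w lo hi B; lra.
- by move=> B _; have := LB_le_UB w lo hi B; lra.
Qed.

(** The deficient block keeps its [z] strictly below [UB / 2], and no other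
    block can exceed its own half upper bound to make up for it. *)
Lemma deficient_not_in_relaxation w b lo hi P S x :
    S \in P -> partial_dot w x S < (LB w lo hi S + UB w lo hi S) / 2 ->
  ~ relaxation w b lo hi P (x, (\sum_(B in P) UB w lo hi B + b) / 2, 2^-1).
Proof.
move=> SP xS [_ _ _ [z [_ _ out bda bdb]]].
have : \sum_(B in P) z B < \sum_(B in P) UB w lo hi B / 2.
  rewrite (big_setD1 S) //= [ltRHS](big_setD1 S) //=.
  apply: ltr_leD; first by move: (bda S SP); lra.
  by apply: ler_sum => B /setD1P[_ BP]; move: (bdb B BP); lra.
by rewrite -mulr_suml; lra.
Qed.

(** * Points with prescribed block values *)

(** The sign of [w i] decides which end of the interval gives the minimum of
    [w i * x i], hence in which direction [x i] has to move. *)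
Definition interpolate w lo hi (t : 'I_eta -> R) : 'cV[R]_eta :=
  \col_i (if 0 <= w i 0 then (1 - t i) * lo i 0 + t i * hi i 0
          else (1 - t i) * hi i 0 + t i * lo i 0).

Lemma interpolate_box w lo hi t :
    (forall i, lo i 0 <= hi i 0) -> (forall i, 0 <= t i <= 1) ->
  box lo hi (interpolate w lo hi t).
Proof.
move=> lohi t01 i; rewrite mxE; have := lohi i; have := t01 i.
by case: ifP => _; nra.
Qed.

Lemma partial_dot_interpolate w lo hi t (c : R) B :
    (forall i, lo i 0 <= hi i 0) -> (forall i, i \in B -> t i = c) ->
  partial_dot w (interpolate w lo hi t) B
  = (1 - c) * LB w lo hi B + c * UB w lo hi B.
Proof.
move=> lohi tc; rewrite /partial_dot /LB /UB !mulr_sumr -big_split /=.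
apply: eq_bigr => i iB; rewrite mxE tc //.
case: ifP => [w0|/negbT]; [|rewrite -ltNge => w0].
  have le_w : w i 0 * lo i 0 <= w i 0 * hi i 0 by apply: ler_wpM2l.
  by rewrite (min_idPl le_w) (max_idPr le_w); ring.
have le_w : w i 0 * hi i 0 <= w i 0 * lo i 0 by apply: ler_wnM2l (ltW w0) _ _ (lohi i).
by rewrite (min_idPr le_w) (max_idPl le_w); ring.
Qed.

(** With interval widths [dS] and [dT], shifting the interpolation parameter
    from [1/2] by [- dT / (2 (dS + dT))] on [S] and by [dS / (2 (dS + dT))] on
    [T] moves the two dot products by opposite amounts, and keeps both
    parameters in [[0, 1]]. *)
Lemma exists_unbalanced_pair w lo hi S T :
    (forall i, lo i 0 <= hi i 0) -> [disjoint S & T]%B ->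
    LB w lo hi S < UB w lo hi S -> LB w lo hi T < UB w lo hi T ->
  exists x, [/\ box lo hi x,
    partial_dot w x S < (LB w lo hi S + UB w lo hi S) / 2,
    partial_dot w x (S :|: T)%SET
      = (LB w lo hi (S :|: T)%SET + UB w lo hi (S :|: T)%SET) / 2 &
    forall B, [disjoint B & S]%B -> [disjoint B & T]%B ->
      partial_dot w x B = (LB w lo hi B + UB w lo hi B) / 2].
Proof.
move=> lohi dST ltS ltT.
set LS := LB w lo hi S in ltS *; set US := UB w lo hi S in ltS *.
set LT := LB w lo hi T in ltT *; set UT := UB w lo hi T in ltT *.
pose r := (US - LS) / (2 * ((US - LS) + (UT - LT))).
have D0 : 0 < (US - LS) + (UT - LT) by lra.
have rE : r * (2 * ((US - LS) + (UT - LT))) = US - LS.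
  by rewrite /r; field; lra.
have r0 : 0 < r by rewrite /r divr_gt0 ?mulr_gt0; lra.
have r_lt : r < 1 / 2 by rewrite /r ltr_pdivrMr; lra.
(* The parameter on [S] simplifies to [r], and on [T] to [1/2 + r]. *)
pose t i : R := if i \in S then r else if i \in T then 1 / 2 + r else 1 / 2.
have tS : partial_dot w (interpolate w lo hi t) S = (1 - r) * LS + r * US.
  by apply: partial_dot_interpolate => // i iS; rewrite /t iS.
have tT : partial_dot w (interpolate w lo hi t) T
    = (1 - (1 / 2 + r)) * LT + (1 / 2 + r) * UT.
  apply: partial_dot_interpolate => // i iT.
  by rewrite /t (disjointFl dST iT) iT.
exists (interpolate w lo hi t); split.
- by apply: interpolate_box => // i; rewrite /t; do 2?[case: ifP => _]; lra.
- by rewrite tS; nra.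
- by rewrite partial_dotU // LBU // UBU // tS tT -/LS -/US -/LT -/UT; lra.
- move=> B dBS dBT; rewrite (partial_dot_interpolate _ (c := 1 / 2)) //; first lra.
  by move=> i iB; rewrite /t (disjointFr dBS iB) (disjointFr dBT iB).
Qed.

End Merging.

Theorem proposition4 (R : realType) (eta N : nat)
    (w lo hi : 'cV[R]_eta) (b : R)
    (lo_le_hi : forall i, lo i 0 <= hi i 0)
    (P P' : {set {set 'I_eta}}) (S T : {set 'I_eta})
    (N_ge2 : (2 <= N)%N)
    (partP : finset.partition P [set: 'I_eta]%SET) (cardP : #|P| = N)
    (SP : S \in P) (TP : T \in P) (neqST : S != T)
    (mergeP' : P' = merge_blocks P S T) :
  relaxation w b lo hi P `<=` relaxation w b lo hi P' /\
  (LB w lo hi S < UB w lo hi S ->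
   LB w lo hi T < UB w lo hi T ->
   LB w lo hi [set: 'I_eta]%SET + b <= 0 <= UB w lo hi [set: 'I_eta]%SET + b ->
   relaxation w b lo hi P `<` relaxation w b lo hi P').
Proof.
rewrite {}mergeP'; have sub := relaxation_merge (w := w) (b := b) (lo := lo)
  (hi := hi) partP SP TP neqST.
split=> // ltS ltT lub; split=> // supR.
have disj := partition_blocks_disjoint partP.
have dST := disj _ _ SP TP neqST.
have [x [xbox xS xU xB]] := exists_unbalanced_pair lo_le_hi dST ltS ltT.
apply: (deficient_not_in_relaxation (b := b) SP xS).
rewrite (partition_sum_UB _ _ _ partP); apply: supR.
apply: (balanced_in_relaxation _ _ lub) => //.
- rewrite (merge_blocks_sum (G := LB w lo hi) partP) ?LBU //.
  exact: partition_sum_LB.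
- rewrite (merge_blocks_sum (G := UB w lo hi) partP) ?UBU //.
  exact: partition_sum_UB.
- move=> B /merge_blocksP[-> //|].
  by rewrite !inE => /and3P[BT BS BP]; apply: xB; apply: disj.
Qed.
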